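(* Let $(W,Y)$ and $(W',Y')$ be random vectors on a common probability space satisfying the following. (I) $\mathbb{E}W=0$, $\operatorname{Var}(W)=1$; $\mathbb{E}Y=0$, $\operatorname{Var}(Y)=\sigma_Y^2$; $W$ and $Y$ are uncorrelated; and $(W,Y,W',Y')\overset{d}{=}(W',Y',W,Y)$ (exchangeability). (II) $Y$ takes values in $\zeta+\mathbb{Z}$ for some $\zeta\in[0,1)$, $\Delta Y:=Y'-Y\in\{-1,0,1\}$ almost surely, and $M_{0,\pm}(W,Y)=Q+R_{0,\pm}$, where $Q=\lambda\sigma_Y^2$ for some $\lambda\in(0,1)$ and $R_{0,\pm}$ are random variables. (III) $M_{1,\pm}(W,Y)=-\lambda\left(\tfrac12\psi W+R_{1,\pm}\right)$ for some number $\psi>0$ and random variables $R_{1,\pm}$. (IV) $M_{2,\pm}(W,Y)=\lambda(\psi+R_{2,\pm})$ for random variables $R_{2,\pm}$. Let $k$ be such that $p_k:=\mathbb{P}(Y=k)>0$. Then $$d_W\big((W\mid Y=k),Z\big)\le \frac{2}{\psi}\Big(A_k+\frac{1}{p_k}C\Big)+\sqrt{\frac{2}{\pi\psi^2}}\Big(B_k+\frac1{p_k}D\Big)+\frac{2}{3\lambda\psi p_k}\,\mathbb{E}|\Delta W|^3,$$ where $A_k=\mathbb{E}(|R_{1,-}|\mid Y=k)$, $B_k=\mathbb{E}(|R_{2,-}|\mid Y=k)$, $C=\mathbb{E}|R_{1,+}-R_{1,-}|$, $D=\mathbb{E}|R_{2,+}-R_{2,-}|$, and $Z$ is a standard normal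 random variable.
   Context: $\Delta W:=W'-W$. For $\ell\ge0$, $M_{\ell,\pm}(W,Y):=\mathbb{E}\big((\Delta W)^\ell\,\mathbf{1}_{\{\Delta Y=\pm1\}}\mid W,Y\big)$ (the ''+'' and ''−'' versions being two separate quantities; in particular $M_{0,\pm}=\mathbb{P}(\Delta Y=\pm1\mid W,Y)$). For a random variable $V$ and event $B$ of positive probability, $d_W((V\mid B),Z):=\sup_h|\mathbb{E}(h(V)\mid B)-\mathbb{E}h(Z)|$, the supremum over all $1$-Lipschitz $h:\mathbb{R}\to\mathbb{R}$ (Wasserstein-1 distance). *)

(* Defs.v *)
From HB Require Import structures.
From mathcomp Require Import all_boot all_order all_algebra.
From mathcomp Require Import all_classical all_reals all_analysis.
Set Implicit Arguments. Unset Strict Implicit. Unset Printing Implicit Defensive.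
Import Order.TTheory GRing.Theory Num.Theory.
Local Open Scope classical_set_scope.
Local Open Scope ring_scope.

Definition condexp_WY {d} {T : measurableType d} {R : realType}
    (P : probability T R) (W Y X M : T -> R) : Prop :=
  (exists g : R * R -> R, measurable_fun setT g /\
     {ae P, forall w, M w = g (W w, Y w)}) /\
  P.-integrable setT (EFin \o X) /\ P.-integrable setT (EFin \o M) /\
  forall B : set (R * R), measurable B ->
    (\int[P]_(w in (fun w => (W w, Y w)) @^-1` B) (X w)%:E =
     \int[P]_(w in (fun w => (W w, Y w)) @^-1` B) (M w)%:E)%E.

Definition condE_event {d} {T : measurableType d} {R : realType}
    (P : probability T R) (A : set T) (f : T -> \bar R) : \bar R :=
  ((\int[P]_(w in A) f w) * ((fine (P A))^-1)%:E)%E.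

Definition one_lipschitz {R : realType} (h : R -> R) : Prop :=
  forall x y, `|h x - h y| <= `|x - y|.

Definition dW_cond_normal {d} {T : measurableType d} {R : realType}
    (P : probability T R) (V : T -> R) (A : set T) : \bar R :=
  ereal_sup [set `| condE_event P A (fun w => (h (V w))%:E)
                   - \int[normal_prob 0 1]_x (h x)%:E |%E
            | h in [set h : R -> R | one_lipschitz h]].

(* Main.v *)
Require Import Defs.
From HB Require Import structures.
From mathcomp Require Import all_boot all_order all_algebra.
From mathcomp Require Import all_classical all_reals all_analysis.
From mathcomp Require Import measurable_realfun ring lra.
Import Order.TTheory GRing.Theory Num.Theory.
Import numFieldNormedType.Exports.
Local Open Scope classical_set_scope.
Local Open Scope ring_scope.

(** For a 1-Lipschitz [h], let [f] solve Stein's equation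
    [f' x - x * f x = h x - E h(Z)]; then [|f| <= 1], [|f'| <= sqrt (2 / pi)] and
    [f'] is 2-Lipschitz. Let [s] be the alternating function with
    [s (k + n) = (-1)^n] for natural [n] and [s = 0] elsewhere, so that
    [s (y - 1) = 1_{y = k} - s y]. Exchangeability annihilates the antisymmetric
    statistic

      [(W' - W) f ((W + W') / 2) (1_{Y' = Y + 1} s(Y) + 1_{Y' = Y - 1} s(Y'))],

    where [s(Y') = 1_{Y = k} - s(Y)] when [Y' = Y - 1]. Expand [f] at [W] and condition
    on [(W, Y)]. The term [1_{Y = k}] yields [E ((f'(W) - W f(W)) 1_{Y = k})] up to errors
    in [R1m] and [R2m] on [Y = k]; in the terms carrying [s(Y)] the main parts of the
    two conditional moments cancel and only [R1p - R1m] and [R2p - R2m] survive. *)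

(** * Gaussian integrals *)

Lemma one_lipschitz_continuous {R : realType} (h : R -> R) :
  one_lipschitz h -> continuous h.
Proof.
move=> lh x; apply/cvgrPdist_le => e e0.
have := nbhsx_ballx x e e0; apply: filterS => y /ltW.
exact: le_trans.
Qed.

Section gaussian.
Context {R : realType}.
Implicit Types (x w : R) (u h : R -> R).
Local Notation mu := (@lebesgue_measure R).
Local Notation phi := (@normal_pdf R 0 1).

(** The normalising constant stays hidden in the factor [phi 0], in which the bounds below are
    expressed; [2 * phi 0] is the square root of 2 / pi. *)
Lemma phiE x : phi x = phi 0 * expR (- (x ^+ 2 / 2)).
Proof.
have e y : phi y = normal_peak 1 * expR (- (y ^+ 2 / 2)).
  by rewrite normal_pdfE ?oner_neq0// /normal_fun subr0 expr1n mulNr.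
by rewrite !e expr0n/= mul0r oppr0 expR0 mulr1.
Qed.

Lemma phi0E : phi 0 = (Num.sqrt (2 * pi))^-1.
Proof.
rewrite normal_pdfE ?oner_neq0// /normal_fun subr0 expr0n/= oppr0 mul0r expR0.
by rewrite mulr1 /normal_peak expr1n mul1r mulr_natl.
Qed.

Lemma phi0_gt0 : 0 < phi 0.
Proof. by rewrite phi0E invr_gt0 sqrtr_gt0 mulr_gt0// pi_gt0. Qed.

Lemma phi0_sqr : phi 0 ^+ 2 = (2 * pi)^-1.
Proof. by rewrite phi0E exprVn sqr_sqrtr// mulr_ge0// pi_ge0. Qed.

Lemma phi_gt0 x : 0 < phi x.
Proof. by rewrite phiE mulr_gt0 ?phi0_gt0 ?expR_gt0. Qed.

Lemma phiN x : phi (- x) = phi x.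
Proof. by rewrite phiE sqrrN -phiE. Qed.

Lemma phi_le0 x : phi x <= phi 0.
Proof.
rewrite phiE ler_piMr ?(ltW phi0_gt0)// -[leRHS]expR0 ler_expR oppr_le0.
by rewrite divr_ge0 ?sqr_ge0.
Qed.

Lemma is_derive_phi x : is_derive x 1 phi (- (x * phi x)).
Proof.
have -> : phi = (fun y => phi 0 * expR (- (y ^+ 2 / 2))) by apply/funext/phiE.
apply: is_derive_eq; rewrite /GRing.scale/=.
by field.
Qed.

Lemma continuous_phi : continuous phi.
Proof. by apply: continuous_normal_pdf; rewrite oner_neq0. Qed.

Lemma cvg_phi : phi x @[x --> +oo] --> (0 : R).
Proof.
(* Expanding (x - 1)^2 >= 0 gives -x^2 / 2 <= 1/2 - x, hence this dominating function. *)
apply: (@squeeze_cvgr _ _ _ _ (cst 0) (fun x => phi 0 * expR 2^-1 * expR (- x))).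
- apply: nearW => x; rewrite (ltW (phi_gt0 _))/= phiE -mulrA.
  rewrite ler_wpM2l ?(ltW phi0_gt0)// -expRD ler_expR.
  by have := sqr_ge0 (x - 1); lra.
- exact: cvg_cst.
- rewrite -[X in _ --> X](mulr0 (phi 0 * expR 2^-1)).
  by apply: cvgM; [exact: cvg_cst|exact: cvgr_expR].
Qed.

Lemma integrable_phi : mu.-integrable setT (EFin \o phi).
Proof. exact: integrable_normal_pdf. Qed.

(* [|a + b |x|| <= (|a| + |b|) (1 + x^2 / 4) <= (|a| + |b|) exp (x^2 / 4)] bounds the
   integrand by a multiple of the density of variance 2. *)
Lemma integrable_lin_phi (a b : R) :
  mu.-integrable setT (fun x => ((a + b * `|x|) * phi x)%:E).
Proof.
have s2 : Num.sqrt 2 != 0 :> R by rewrite sqrtr_eq0 -ltNge.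
pose C := (`|a| + `|b|) * phi 0 * (normal_peak (Num.sqrt 2 : R))^-1.
apply: (@le_integrable _ _ _ mu _ measurableT _ (fun x =>
   C%:E * (normal_pdf 0 (Num.sqrt 2) x)%:E)%E) => //=.
- apply/measurable_EFinP/measurable_funM; last exact: measurable_normal_pdf.
  apply: measurable_funD => //; apply: measurable_funM => //.
- move=> x _; rewrite lee_fin (@normal_pdfE _ 0 _ s2) /normal_fun subr0 sqr_sqrtr//.
  rewrite [leRHS]ger0_norm; last first.
    by rewrite !mulr_ge0 ?addr_ge0 ?invr_ge0 ?normal_peak_ge0 ?expR_ge0 ?(ltW phi0_gt0).
  rewrite normrM (gtr0_norm (phi_gt0 x)) phiE.
  have p2 : normal_peak (Num.sqrt 2 : R) != 0 by rewrite gt_eqF// normal_peak_gt0.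
  have -> : - x ^+ 2 / (2 *+ 2) = - (x ^+ 2 / 2) + x ^+ 2 / 4 :> R by field.
  rewrite expRD.
  have : `|a + b * `|x| | <= (`|a| + `|b|) * expR (x ^+ 2 / 4).
    have /le_trans : `|a + b * `|x| | <= (`|a| + `|b|) * (1 + x ^+ 2 / 4).
      apply: le_trans (ler_normD _ _) _; rewrite normrM normr_id.
      have := normr_ge0 a; have := normr_ge0 b; move: `|a| `|b| => a' b' b0 a0.
      rewrite -(real_normK (num_real x)); move: `|x| => y.
      have h1 : y <= 1 + y ^+ 2 / 4 by have := sqr_ge0 (y / 2 - 1); nra.
      have h2 : 0 <= y ^+ 2 / 4 by rewrite divr_ge0 ?sqr_ge0.
      nra.
    apply; apply: ler_wpM2l; first by rewrite addr_ge0.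
    exact: expR_ge1Dx.
  move=> /(ler_wpM2r (ltW (phi_gt0 x)))/le_trans; rewrite phiE; apply.
  by rewrite le_eqVlt; apply/orP; left; apply/eqP; rewrite /C; field.
- exact: (@integrableZl _ _ _ mu _ measurableT C _ (integrable_normal_pdf _ _)).
Qed.

Lemma integrable_lip_phi h : one_lipschitz h ->
  mu.-integrable setT (EFin \o (fun x => h x * phi x)).
Proof.
move=> lh; apply: le_integrable (integrable_lin_phi `|h 0| 1) => //.
- apply/measurable_EFinP/measurable_funM; last exact: measurable_normal_pdf.
  by apply: continuous_measurable_fun; exact: one_lipschitz_continuous.
- move=> x _; rewrite lee_fin !normrM ler_wpM2r//.
  rewrite [leRHS]ger0_norm ?addr_ge0 ?mul1r// -[h x](subrK (h 0)) addrC.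
  by rewrite (le_trans (ler_normD _ _))// lerD2l (le_trans (lh _ _))// subr0.
Qed.

(** The truncated expectation E(u(Z); Z <= x). For [u = h] it enters the solution of Stein's
    equation; [u = 1] gives the distribution function and [u = id] gives [- phi]. *)
Definition gauss_int u x : R := \int[mu]_(t in `]-oo, x]) (u t * phi t).

Lemma is_derive_gauss_int u x : continuous u ->
  mu.-integrable setT (EFin \o (fun x => u x * phi x)) ->
  is_derive x 1 (gauss_int u) (u x * phi x).
Proof.
move=> cu iu.
(* The end point [x + 1] only makes [x] an interior point. *)
have [] := @continuous_FTC1 R (fun t => u t * phi t) -oo%O x (x + 1).
- by rewrite ltrDl.
- exact: integrableS iu.
- by rewrite ltNyr.
- by apply: continuousM; [exact: cu|exact: continuous_phi].
move=> d e; apply: DeriveDef => //.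
by rewrite -derive1E.
Qed.


(** * The normal distribution function and first-moment integrals *)

Definition Phi x : R := \int[mu]_(t in `]-oo, x]) phi t.

Lemma is_derive_Phi x : is_derive x 1 Phi (phi x).
Proof.
have -> : Phi = gauss_int (cst 1).
  by apply/funext => y; apply: eq_Rintegral => t _; rewrite mul1r.
rewrite -[phi x]mul1r; apply: is_derive_gauss_int; first exact: cst_continuous.
have -> : (fun x => cst 1 x * phi x) = phi by apply/funext => t; rewrite mul1r.
exact: integrable_phi.
Qed.

Lemma gauss_int_tail u x :
  mu.-integrable setT (EFin \o (fun x => u x * phi x)) ->
  \int[mu]_(t in `]x, +oo[) (u t * phi t) = \int[mu]_t (u t * phi t) - gauss_int u x.
Proof.
move=> iu; have <- := @Rintegral_itvB R (fun t => u t * phi t) -oo%O +oo%O x.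
- by rewrite set_itvNyy.
- by rewrite set_itvNyy.
- by rewrite bnd_simp.
- by rewrite bnd_simp.
Qed.

Lemma integrable_id_phi : mu.-integrable setT (EFin \o (fun t => t * phi t)).
Proof. by apply: (@integrable_lip_phi id) => x y. Qed.

(** The function [- phi] is an antiderivative of the integrand and vanishes at infinity. *)
Lemma integral_xphi_0y : (\int[mu]_(x in `[0%R, +oo[) (x * phi x)%:E = (phi 0)%:E)%E.
Proof.
rewrite (@ge0_continuous_FTC2y _ _ (\- phi) _ (- 0)).
- by rewrite -EFinB oppr0 sub0r opprK.
- by move=> x x0; rewrite mulr_ge0// ltW// phi_gt0.
- apply: continuous_subspaceT => x; apply: continuousM; first exact: cvg_id.
  exact: continuous_phi.
- exact: cvgN cvg_phi.
- move=> x _; apply: derivableN; have d := is_derive_phi x; exact: ex_derive.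
- apply: cvg_at_right_filter; apply: cvgN; exact: continuous_phi.
- move=> x _; rewrite derive1E deriveN; last by have d := is_derive_phi x; exact: ex_derive.
  by rewrite (@derive_val _ _ _ _ _ _ _ (is_derive_phi x)) opprK.
Qed.

(** The minus sign makes the integrand nonnegative on the left half-line, so that substituting -x
    for x reduces it to the previous integral. *)
Lemma integral_xphi_Ny0 : (\int[mu]_(x in `]-oo, 0%R]) (- (x * phi x))%:E = (phi 0)%:E)%E.
Proof.
rewrite -integral_xphi_0y -{1}oppr0 (@ge0_integration_by_substitutionNy _ (fun x => - (x * phi x)) 0).
- by apply: eq_integral => x _; rewrite /= phiN mulNr opprK.
- apply: continuous_subspaceT => x; apply: cvgN; apply: continuousM; first exact: cvg_id.
  exact: continuous_phi.
- move=> x; rewrite in_itv/= oppr0 => x0.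
  by rewrite -mulNr mulr_ge0 ?oppr_ge0 ?ltW// phi_gt0.
Qed.

(** Since [phi] is even, both half-lines carry the same mass, and the total is 1. *)
Lemma Phi0 : Phi 0 = 2^-1.
Proof.
have e : (\int[mu]_(x in `]-oo, 0%R]) (phi x)%:E = \int[mu]_(x in `[0%R, +oo[) (phi x)%:E)%E.
  rewrite -{1}oppr0 (@ge0_integration_by_substitutionNy _ phi 0).
  - by apply: eq_integral => x _; rewrite /= phiN.
  - apply: continuous_subspaceT; exact: continuous_phi.
  - move=> x _; exact/ltW/phi_gt0.
have := @Rintegral_itvB R phi -oo%O +oo%O 0.
rewrite set_itvNyy => /(_ integrable_phi); rewrite bnd_simp => /(_ isT isT).
rewrite Rintegral_itv_obnd_cbnd; last exact: integrableS integrable_phi.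
rewrite /Phi /Rintegral -e integral_normal_pdf /=.
by move=> h; lra.
Qed.

(** The sum of [Phi (- y)] and [Phi y] has derivative zero, and equals 1 at 0. *)
Lemma PhiN x : Phi (- x) = 1 - Phi x.
Proof.
have h (y : R) : is_derive y (1 : R) (fun y : R => Phi (- y) + Phi y) 0.
  have d1 := is_derive_Phi y; have d2 := is_derive_Phi (- y).
  have d3 : is_derive y 1 (fun y : R => Phi (- y)) (- phi y).
    have := @is_derive1_comp _ Phi -%R y _ _ d2 (is_deriveNid y 1).
    by rewrite phiN mulrN1.
  by apply: is_derive_eq; rewrite addNr.
have := @is_derive_0_is_cst _ _ x 0 h.
by rewrite oppr0 Phi0 => h'; lra.
Qed.

(** Both sides have derivative [x * phi x]; the half-line integral above shows that they agree at
    0. *)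
Lemma gauss_int_id x : gauss_int id x = - phi x.
Proof.
have h (y : R) : is_derive y (1 : R) (fun y : R => gauss_int id y + phi y) 0.
  have d1 := is_derive_phi y.
  have d2 := @is_derive_gauss_int id y (fun x => cvg_id) integrable_id_phi.
  by apply: is_derive_eq; rewrite addrN.
have := @is_derive_0_is_cst _ _ x 0 h.
suff -> : gauss_int id 0 = - phi 0 by rewrite addNr => /eqP; rewrite addr_eq0 => /eqP.
rewrite /gauss_int /Rintegral; apply: oppr_inj; rewrite opprK.
have -> : phi 0 = fine (phi 0)%:E by [].
rewrite -integral_xphi_Ny0 -fineN -integralN.
  by congr fine; apply: eq_integral => t _; rewrite EFinN.
apply: integrable_add_def => //; by apply: integrableS integrable_id_phi.
Qed.

Lemma integral_id_phi : \int[mu]_t (t * phi t) = 0.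
Proof.
have := @gauss_int_tail id 0 integrable_id_phi.
rewrite Rintegral_itv_obnd_cbnd; last exact: integrableS integrable_id_phi.
rewrite gauss_int_id {1}/Rintegral integral_xphi_0y/= => h; lra.
Qed.

Lemma Rintegral_phi : \int[mu]_t (phi t) = 1.
Proof. by rewrite /Rintegral integral_normal_pdf. Qed.

Lemma Rintegral_phi_tail x : \int[mu]_(t in `]x, +oo[) (phi t) = 1 - Phi x.
Proof.
have <- := @Rintegral_itvB R phi -oo%O +oo%O x.
- by rewrite set_itvNyy Rintegral_phi.
- by rewrite set_itvNyy; exact: integrable_phi.
- by rewrite bnd_simp.
- by rewrite bnd_simp.
Qed.

End gaussian.

(** * Stein's equation *)

(* Plays the role of a limit at infinity in the monotonicity arguments below. *)
Lemma ge0_of_geNdiv {R : realType} (a K w : R) :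
  (forall x, 0 < x -> w <= x -> - K / x <= a) -> 0 <= a.
Proof.
move=> H; rewrite leNgt; apply/negP => a0.
pose x := Num.max (Num.max 1 w) (`|K| / - a + 1).
have x0 : 0 < x by rewrite !lt_max ltr01.
have wx : w <= x by rewrite !le_max lexx orbT.
have xK : `|K| / - a + 1 <= x by rewrite le_max lexx orbT.
have := H _ x0 wx; rewrite ler_pdivrMr// => h.
have : `|K| < x * - a by rewrite -ltr_pdivrMr ?oppr_gt0//; lra.
by have := ler_norm K; lra.
Qed.

Lemma is_derive_le {R : realType} (f df : R -> R) (a b : R) :
  (forall x : R, a <= x -> is_derive x 1 f (df x)) ->
  (forall x, a <= x -> 0 <= df x) -> a <= b -> f a <= f b.
Proof.
move=> d df0 ab; have [||c + e] := @MVT_segment _ f df a b ab.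
- by move=> x; rewrite in_itv/= => /andP[/ltW ax _]; exact: d.
- apply: derivable_within_continuous => x; rewrite in_itv/= => /andP[ax _].
  by have dx := d _ ax; exact: ex_derive.
rewrite in_itv/= => /andP[ac _].
by rewrite -subr_ge0 e mulr_ge0 ?df0// subr_ge0.
Qed.

Section integrable_real.
Context d (T : measurableType d) (R : realType) (m : {measure set T -> \bar R}).
Implicit Types (A : set T) (f g : T -> R).

(** This and the next two lemmas keep the arithmetic in the reals, under a single [EFin], which is
    the form of the integrands below. *)
Lemma integrableZr_EFin A f (c : R) : measurable A ->
  m.-integrable A (EFin \o f) -> m.-integrable A (EFin \o (fun t => c * f t)).
Proof.
move=> mA mf; apply: eq_integrable (integrableZl mA c mf) => // t _.
Qed.

Lemma integrableD_EFin A f g : measurable A ->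
  m.-integrable A (EFin \o f) -> m.-integrable A (EFin \o g) ->
  m.-integrable A (EFin \o (fun t => f t + g t)).
Proof. by move=> mA mf mg; apply: eq_integrable (integrableD mA mf mg). Qed.

Lemma integrableB_EFin A f g : measurable A ->
  m.-integrable A (EFin \o f) -> m.-integrable A (EFin \o g) ->
  m.-integrable A (EFin \o (fun t => f t - g t)).
Proof. by move=> mA mf mg; apply: eq_integrable (integrableB mA mf mg). Qed.

End integrable_real.

Section stein.
Context {R : realType}.
Implicit Types (x w : R) (u h : R -> R).
Local Notation mu := (@lebesgue_measure R).
Local Notation phi := (@normal_pdf R 0 1).
Local Notation Phi := (@Phi R).

(** Integrates [|h t - h w| <= |t - w|] against [phi]. On a half-line ending at [w] the right side
    is explicit. *)
Lemma Rintegral_lip_phi_le (A : set R) h w : measurable A -> one_lipschitz h ->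
  `|\int[mu]_(t in A) (h t * phi t) - h w * \int[mu]_(t in A) phi t| <=
  \int[mu]_(t in A) (`|t - w| * phi t).
Proof.
move=> mA lh.
have iphi : mu.-integrable A (EFin \o phi) by exact: integrableS (integrable_phi).
have ih : mu.-integrable A (EFin \o (fun t => h t * phi t)).
  exact: integrableS (integrable_lip_phi _ lh).
have ihw : mu.-integrable A (EFin \o (fun t => h w * phi t)).
  exact: (integrableZl _ (h w) iphi).
have iw : mu.-integrable A (EFin \o (fun t => `|t - w| * phi t)).
  apply: integrableS (integrable_lip_phi (fun t => `|t - w|) _) => // x y.
  by rewrite (le_trans (ler_dist_dist _ _))// opprB addrA subrK.
rewrite -RintegralZl// -RintegralB// (le_trans (le_normr_Rintegral _ _))//.
  exact: integrableB_EFin.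
apply: le_Rintegral => //.
  by apply: (integrable_norm (f := fun t => _)); exact: integrableB_EFin.
move=> t _; rewrite -mulrBl normrM (gtr0_norm (phi_gt0 _)).
by rewrite ler_wpM2r ?lh// ltW ?phi_gt0.
Qed.

(** To the left of [w] the distance is w - t, and [t * phi t] integrates to [- phi w] there. *)
Lemma gauss_int_lip_le h w : one_lipschitz h ->
  `|gauss_int h w - h w * Phi w| <= phi w + w * Phi w.
Proof.
move=> lh; apply: (le_trans (@Rintegral_lip_phi_le `]-oo, w] h w _ lh)) => //.
have -> : \int[mu]_(t in `]-oo, w]) (`|t - w| * phi t) =
    \int[mu]_(t in `]-oo, w]) (w * phi t - t * phi t).
  apply: eq_Rintegral.
  by move=> t; rewrite inE/= in_itv/= => tw; rewrite ler0_norm ?subr_le0// opprB mulrBl.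
rewrite RintegralB//.
- rewrite RintegralZl//; last exact: integrableS integrable_phi.
  by have := gauss_int_id w; rewrite /gauss_int => ->; rewrite opprK addrC.
- by apply: integrableZr_EFin => //; apply: integrableS integrable_phi.
- exact: integrableS integrable_id_phi.
Qed.

(** To the right of [w] the distance is t - w; as [t * phi t] has total integral 0, its tail
    integral is [phi w]. *)
Lemma gauss_tail_lip_le h w : one_lipschitz h ->
  `|\int[mu]_t (h t * phi t) - gauss_int h w - h w * (1 - Phi w)| <=
  phi w - w * (1 - Phi w).
Proof.
move=> lh; rewrite -gauss_int_tail; last exact: integrable_lip_phi.
rewrite -Rintegral_phi_tail.
apply: (le_trans (@Rintegral_lip_phi_le `]w, +oo[ h w _ lh)) => //.
have -> : \int[mu]_(t in `]w, +oo[) (`|t - w| * phi t) =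
    \int[mu]_(t in `]w, +oo[) (t * phi t - w * phi t).
  apply: eq_Rintegral.
  by move=> t; rewrite inE/= in_itv/= andbT => tw; rewrite gtr0_norm ?subr_gt0// mulrBl.
rewrite RintegralB//.
- rewrite RintegralZl//; last exact: integrableS integrable_phi.
  rewrite (@gauss_int_tail _ id)//; last exact: integrable_id_phi.
  by rewrite integral_id_phi gauss_int_id opprK add0r.
- exact: integrableS integrable_id_phi.
- by apply: integrableZr_EFin => //; apply: integrableS integrable_phi.
Qed.

Lemma Phi_ge0 x : 0 <= Phi x.
Proof. by apply: Rintegral_ge0 => t _; rewrite ltW// phi_gt0. Qed.

Lemma Phi_le1 x : Phi x <= 1.
Proof. by rewrite -subr_ge0 -PhiN Phi_ge0. Qed.

(* [x phi x / (1 + x^2) - (1 - Phi x)] has derivative [2 phi x / (1 + x^2)^2 >= 0] and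
   tends to 0 at infinity. *)
Lemma mills w : w * phi w <= (1 + w ^+ 2) * (1 - Phi w).
Proof.
have p x : 0 < 1 + x ^+ 2 by have := sqr_ge0 x; lra.
suff : 0 <= 1 - Phi w - w * phi w / (1 + w ^+ 2).
  by rewrite subr_ge0 ler_pdivrMr ?p// [leRHS]mulrC.
apply: (@ge0_of_geNdiv _ _ (phi 0) w) => x x0 wx.
pose n x := x * phi x / (1 + x ^+ 2) - (1 - Phi x).
have nle : n w <= n x.
  apply: (@is_derive_le _ n (fun x => 2 * phi x / (1 + x ^+ 2) ^+ 2) w x) => [y _|y _|]; last by [].
    have d1 := is_derive_phi y; have d2 := is_derive_Phi y.
    have d3 : is_derive y (1 : R) (fun y : R => (1 + y ^+ 2)^-1) (- (2 * y) / (1 + y ^+ 2) ^+ 2).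
      apply: is_derive_eq; first by apply: is_deriveV; rewrite gt_eqF.
      rewrite /GRing.scale/=; field; by rewrite gt_eqF.
    apply: is_derive_eq; rewrite /GRing.scale/=; field; by rewrite gt_eqF.
  by rewrite divr_ge0 ?sqr_ge0 ?mulr_ge0// ltW// phi_gt0.
have h1 := Phi_le1 x.
have h2 : x * phi x / (1 + x ^+ 2) <= phi 0 / x.
  rewrite ler_pdivrMr// mulrAC ler_pdivlMr//.
  have h3 := phi_le0 x; have h4 := phi_gt0 x; have h5 := @phi0_gt0 R.
  have h6 : x ^+ 2 * phi x <= x ^+ 2 * phi 0 by rewrite ler_wpM2l ?sqr_ge0.
  lra.
by move: nle; rewrite /n mulNr; lra.
Qed.

(** The reflection of [mills], which fixes the sign of the second coefficient in the bound on f + x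
    f'. *)
Lemma millsN w : 0 <= (1 + w ^+ 2) * Phi w + w * phi w.
Proof. by have := mills (- w); rewrite sqrrN phiN PhiN; lra. Qed.

(* With [J] the difference of the two sides, [- J x / x^2] has derivative
   [phi x * k x / x^3] where [k] is nonnegative because [k 0 = k' 0 = 0] and
   [k'' x = 2 (phi 0 - phi x)]; moreover [J x / x^2 >= - phi 0 / x]. *)
Lemma mills_prod_le w :
  (phi w - w * (1 - Phi w)) * (phi w + w * Phi w) <= phi w * phi 0.
Proof.
wlog : w / 0 <= w => [H|].
  have [/H//|/ltW w0] := leP 0 w.
  by have := H (- w); rewrite oppr_ge0 phiN PhiN => /(_ w0); lra.
rewrite le_eqVlt => /predU1P[<-|w0]; first by rewrite !mul0r subr0 addr0.
pose J x := phi x * phi 0 - (phi x - x * (1 - Phi x)) * (phi x + x * Phi x).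
have k0 x : 0 <= x -> 0 <= phi 0 * x ^+ 2 + 2 * phi 0 - 2 * phi x - x * (2 * Phi x - 1).
  move=> x0; pose k x := phi 0 * x ^+ 2 + 2 * phi 0 - 2 * phi x - x * (2 * Phi x - 1).
  suff : k 0 <= k x by rewrite /k; lra.
  apply: (@is_derive_le _ k (fun x => 2 * phi 0 * x - (2 * Phi x - 1)) 0 x) => [y _|y y0|]; last by [].
    have d1 := is_derive_phi y; have d2 := is_derive_Phi y.
    by apply: is_derive_eq; rewrite /GRing.scale/=; ring.
  pose l x := 2 * phi 0 * x - (2 * Phi x - 1).
  suff : l 0 <= l y by rewrite /l Phi0; lra.
  apply: (@is_derive_le _ l (fun x => 2 * phi 0 - 2 * phi x) 0 y) => [z _|z _|]; last by [].
    have d2 := is_derive_Phi z.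
    by apply: is_derive_eq; rewrite /GRing.scale/=; ring.
  by have := phi_le0 z; lra.
suff : 0 <= J w / w ^+ 2.
  by rewrite pmulr_lge0 ?invr_gt0 ?exprn_gt0// /J subr_ge0.
apply: (@ge0_of_geNdiv _ _ (phi 0) w) => x x0 wx.
pose V x := - (J x / x ^+ 2).
have Jle : V w <= V x.
  apply: (@is_derive_le _ V (fun x => phi x *
    (phi 0 * x ^+ 2 + 2 * phi 0 - 2 * phi x - x * (2 * Phi x - 1)) / x ^+ 3) w x) => [y wy|y wy|]; last by [].
  - have y0 : 0 < y by exact: lt_le_trans wy.
    have d1 := is_derive_phi y; have d2 := is_derive_Phi y.
    have d3 : is_derive y (1 : R) (fun y : R => (y ^+ 2)^-1) (- 2 / y ^+ 3).
      apply: is_derive_eq; first by apply: is_deriveV; rewrite expf_neq0 ?gt_eqF.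
      rewrite /GRing.scale/=; field; by rewrite gt_eqF.
    rewrite /V /J; apply: is_derive_eq; rewrite /GRing.scale/=; field; by rewrite gt_eqF.
  - have y0 : 0 < y by exact: lt_le_trans wy.
    by rewrite divr_ge0 ?exprn_ge0 ?(ltW y0)// mulr_ge0 ?k0 ?(ltW y0)// ltW// phi_gt0.
suff h0 : - phi 0 / x <= J x / x ^+ 2 by move: Jle; rewrite /V lerN2; exact: le_trans.
rewrite mulNr ler_pdivlMr ?exprn_gt0//.
  have -> : - (phi 0 / x) * x ^+ 2 = - (phi 0 * x) by field; rewrite gt_eqF.
  rewrite /J; have := Phi_le1 x; have := Phi_ge0 x; have := phi_gt0 x; have := phi_le0 x.
  move: (phi 0) (phi x) (Phi x) => p q P qp q0 P0 P1.
  (* Here J x = q (p - q) + x^2 P (1 - P) - x q (2 P - 1); the first two terms are nonnegative and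
     the product subtracted is at most x p. *)
  have h1 : 0 <= q * (p - q) by rewrite mulr_ge0 ?subr_ge0// ltW.
  have h2 : 0 <= x ^+ 2 * (P * (1 - P)) by apply: mulr_ge0; [exact: sqr_ge0|apply: mulr_ge0; [|rewrite subr_ge0]].
  have h3 : q * (2 * P - 1) <= p by nra.
  have h4 : x * (q * (2 * P - 1)) <= x * p by rewrite ler_pM2l.
  nra.
Qed.

(** Used with coefficients of known sign, so that the bounds on [L] and [U] enter without absolute
    values on [a] and [b]. *)
Lemma lincomb_le {a b L U l u : R} : 0 <= a -> 0 <= b -> `|L| <= l -> `|U| <= u ->
  `|a * L - b * U| <= a * l + b * u.
Proof.
move=> a0 b0 Ll Uu; rewrite (le_trans (ler_normB _ _))// !normrM.
by rewrite (ger0_norm a0) (ger0_norm b0) lerD// ler_wpM2l.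
Qed.

(* With [L] and [U] the integrals of [(h t - h x) phi t] over [t <= x] and [t > x],
   [f], [f'] and [f + x f'] are linear combinations of [L] and [U] with coefficients
   of constant sign, so all three are extremal for [h t = |t - x|]. *)
Lemma stein_solution h : one_lipschitz h ->
  exists f f' : R -> R,
  [/\ forall x, is_derive x 1 f (f' x),
      forall x, f' x - x * f x = h x - \int[mu]_t (h t * phi t),
      forall x, `|f x| <= 1,
      forall x, `|f' x| <= 2 * phi 0 &
      forall x y, `|f' x - f' y| <= 2 * `|x - y|].
Proof.
move=> lh; set N := \int[mu]_t (h t * phi t).
(* With the integrating factor [phi], the left side of Stein's equation becomes (f phi)', which is
   integrated from minus infinity. *)
pose f x := (gauss_int h x - N * Phi x) / phi x.
pose f' x := h x - N + x * f x.
have df x : is_derive x 1 f (f' x).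
  have d1 := is_derive_phi x; have d2 := is_derive_Phi x.
  have d3 := is_derive_gauss_int h x (one_lipschitz_continuous h lh) (integrable_lip_phi _ lh).
  have d4 : is_derive x (1 : R) (fun y : R => (phi y)^-1) (x / phi x).
    apply: is_derive_eq; first by apply: is_deriveV; rewrite gt_eqF ?phi_gt0.
    rewrite /GRing.scale/=; field; by rewrite gt_eqF ?phi_gt0.
  apply: is_derive_eq; rewrite /GRing.scale/= /f' /f; field; by rewrite gt_eqF ?phi_gt0.
pose L x := gauss_int h x - h x * Phi x.
pose U x := N - gauss_int h x - h x * (1 - Phi x).
have Ll x : `|L x| <= phi x + x * Phi x by exact: gauss_int_lip_le.
have Uu x : `|U x| <= phi x - x * (1 - Phi x) by exact: gauss_tail_lip_le.
have P1 x : 0 <= 1 - Phi x by rewrite subr_ge0 Phi_le1.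
have fE x : f x = ((1 - Phi x) * L x - Phi x * U x) / phi x.
  by rewrite /f /L /U; congr (_ / _); ring.
have f1 x : `|f x| <= 1.
  rewrite fE normrM normfV (gtr0_norm (phi_gt0 _)) ler_pdivrMr ?phi_gt0//.
  apply: le_trans (lincomb_le (P1 x) (Phi_ge0 x) (Ll x) (Uu x)) _.
  (* The bound is exact: (1 - Phi)(phi + x Phi) + Phi (phi - x (1 - Phi)) = phi. *)
  by rewrite le_eqVlt; apply/orP; left; apply/eqP; ring.
have f'E x : f' x = - ((phi x - x * (1 - Phi x)) * L x + (phi x + x * Phi x) * U x) / phi x.
  rewrite /f' /f /L /U; field; by rewrite gt_eqF ?phi_gt0.
have gE x : f x + x * f' x = (((1 + x ^+ 2) * (1 - Phi x) - x * phi x) * L x -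
     ((1 + x ^+ 2) * Phi x + x * phi x) * U x) / phi x.
  rewrite f'E fE; field; by rewrite gt_eqF ?phi_gt0.
(* This quantity is the derivative of x f(x). [mills] and [millsN] give the signs of its
   coefficients, and the bound again sums to [phi x]. *)
have g1 x : `|f x + x * f' x| <= 1.
  rewrite gE normrM normfV (gtr0_norm (phi_gt0 _)) ler_pdivrMr ?phi_gt0//.
  have M1 : 0 <= (1 + x ^+ 2) * (1 - Phi x) - x * phi x by rewrite subr_ge0 mills.
  apply: le_trans (lincomb_le M1 (millsN x) (Ll x) (Uu x)) _.
  by rewrite le_eqVlt; apply/orP; left; apply/eqP; ring.
exists f, f'; split => //.
- by move=> x; rewrite /f' addrK.
- move=> x; rewrite f'E normrM normfV (gtr0_norm (phi_gt0 _)) ler_pdivrMr ?phi_gt0//.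
  rewrite normrN.
  have I1 : 0 <= phi x - x * (1 - Phi x) by exact: le_trans (normr_ge0 _) (Uu x).
  have I2 : 0 <= phi x + x * Phi x by exact: le_trans (normr_ge0 _) (Ll x).
  have Uu' : `|- U x| <= phi x - x * (1 - Phi x) by rewrite normrN.
  have := lincomb_le I1 I2 (Ll x) Uu'; rewrite mulrN opprK => /le_trans; apply.
  (* Both products in the sum are (phi - x (1 - Phi))(phi + x Phi), hence the factor 2. *)
  by have := mills_prod_le x; lra.
- move=> x y; wlog xy : x y / x <= y => [H|].
    by have [/H//|/ltW/H] := leP x y; rewrite distrC [in leRHS]distrC.
  have dg z : is_derive z (1 : R) (fun z : R => z * f z) (f z + z * f' z).
    by have d := df z; apply: is_derive_eq; rewrite /GRing.scale/=; ring.
  (* Up to a constant, f' is h plus x f(x). The latter is 1-Lipschitz by [g1] and the mean value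
     theorem, so the constants add up to 2. *)
  have -> : f' x - f' y = (h x - h y) - (y * f y - x * f x) by rewrite /f'; ring.
  have [|c _ ->] := @MVT_segment _ (fun z => z * f z) (fun z => f z + z * f' z) x y xy.
    apply: derivable_within_continuous => z _.
    by have dz := dg z; exact: ex_derive.
  have -> : 2 * `|x - y| = `|x - y| + `|x - y| by ring.
  apply: (le_trans (ler_normB _ _)); apply: lerD; first exact: lh.
  by rewrite normrM (distrC y) ler_piMl.
Qed.

End stein.

(** * First-order Taylor expansion with Lipschitz derivative *)

Lemma taylor1_lip_ge0 {R : realType} (f f' : R -> R) (K w t : R) :
  (forall x : R, is_derive x 1 f (f' x)) ->
  (forall x y, `|f' x - f' y| <= K *+ 2 * `|x - y|) -> 0 <= t ->
  `|f (w + t) - f w - t * f' w| <= K * t ^+ 2.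
Proof.
move=> df lf t0.
have dfw s : is_derive s (1 : R) (fun s : R => f (w + s)) (f' (w + s)).
  have := is_deriveD (is_derive_cst w s (1 : R)) (is_derive_id s (1 : R)).
  rewrite add0r => /(@is_derive1_comp _ f _ s _ _ (df (w + s))).
  by rewrite mulr1.
(* For each side, the gap [p] between the two sides vanishes at 0 and has nonnegative derivative, by
   the Lipschitz bound on f'. *)
rewrite ler_norml; apply/andP; split.
- pose p s := f (w + s) - f w - s * f' w + K * s ^+ 2.
  suff : p 0 <= p t by rewrite /p addr0; lra.
  apply: (@is_derive_le _ p (fun s => f' (w + s) - f' w + K *+ 2 * s) 0 t) => [s _|s s0|]; last by [].
    by apply: is_derive_eq; rewrite /GRing.scale/=; ring.
  by have := lf (w + s) w; rewrite addrAC subrr add0r (ger0_norm s0) ler_norml => /andP[]; lra.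
- pose p s := K * s ^+ 2 - (f (w + s) - f w - s * f' w).
  suff : p 0 <= p t by rewrite /p addr0; lra.
  apply: (@is_derive_le _ p (fun s => K *+ 2 * s - (f' (w + s) - f' w)) 0 t) => [s _|s s0|]; last by [].
    by apply: is_derive_eq; rewrite /GRing.scale/=; ring.
  by have := lf (w + s) w; rewrite addrAC subrr add0r (ger0_norm s0) ler_norml => /andP[]; lra.
Qed.

Lemma taylor1_lip {R : realType} (f f' : R -> R) (K w t : R) :
  (forall x : R, is_derive x 1 f (f' x)) ->
  (forall x y, `|f' x - f' y| <= K *+ 2 * `|x - y|) ->
  `|f (w + t) - f w - t * f' w| <= K * t ^+ 2.
Proof.
move=> df lf; have [|/ltW t0] := leP 0 t; first exact: taylor1_lip_ge0.
(* A negative displacement is handled by reflecting [f]. *)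
have := @taylor1_lip_ge0 _ (fun x => f (- x)) (fun x => - f' (- x)) K (- w) (- t).
rewrite opprD !opprK sqrrN mulrNN oppr_ge0; apply => //.
  move=> x; have := @is_derive1_comp _ f -%R x _ _ (df _) (is_deriveNid x 1).
  by rewrite mulrN1.
by move=> x y; rewrite -opprD normrN (le_trans (lf _ _))// -opprD normrN.
Qed.

(** * Integrals against bounded test functions, laws and densities *)

Section bounded_test_functions.
Context d d' (T : measurableType d) (U : measurableType d') (R : realType).
Variables (mu : {measure set T -> \bar R}) (S : T -> U) (N : T -> R).
Hypothesis mS : measurable_fun setT S.
Hypothesis iN : mu.-integrable setT (EFin \o N).
Hypothesis N0 : forall B, measurable B -> (\int[mu]_(w in S @^-1` B) (N w)%:E = 0)%E.

Let mN : measurable_fun setT N.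
Proof. by apply/measurable_EFinP; exact: measurable_int iN. Qed.

Lemma integrable_mul_bounded (g : T -> R) (K : R) :
  measurable_fun setT g -> (forall x, `|g x| <= K) ->
  mu.-integrable setT (fun w => (N w * g w)%:E).
Proof.
move=> mg gK; apply: le_integrable (integrableZr measurableT K (integrable_abse iN)) => //.
- by apply/measurable_EFinP; exact: measurable_funM.
- move=> x _; rewrite /= lee_fin !normrM normr_id ler_wpM2l//.
  by rewrite (le_trans (gK x))// ler_norm.
Qed.

(** Start of the usual extension of [N0]: indicators, simple functions, bounded nonnegative
    functions, bounded functions. In the application [N] is a variable minus its conditional
    expectation and [S] is (W, Y). *)
Lemma integral_mul_indic0 B : measurable B ->
  (\int[mu]_w (N w * \1_B (S w))%:E = 0)%E.
Proof.
move=> mB; rewrite -[RHS](N0 B mB) [RHS]integral_mkcond epatch_indic.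
by apply: eq_integral => w _; rewrite /= EFinM.
Qed.

Import HBNNSimple.

Lemma integral_mul_nnsfun0 (h : {nnsfun U >-> R}) :
  (\int[mu]_w (N w * h (S w))%:E = 0)%E.
Proof.
under eq_integral.
  move=> w _; rewrite fimfunE fsbig_finite//= mulr_sumr.
  rewrite (eq_bigr (fun y => y * (N w * \1_(h @^-1` [set y]) (S w)))); last by move=> y _; ring.
  rewrite -sumEFin; over.
have iB y : mu.-integrable setT (fun w => (N w * \1_(h @^-1` [set y]) (S w))%:E).
  apply: (@integrable_mul_bounded _ 1); first by apply: measurableT_comp => //; exact: measurable_indic.
  by move=> w; rewrite indicE; case: (_ \in _); rewrite ?normr1 ?normr0.
rewrite /= integral_sum//; last first.
  by move=> y; apply: eq_integrable (integrableZl measurableT y (iB y)) => // w _; rewrite EFinM.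
rewrite big1// => y _.
under eq_integral do rewrite EFinM.
by rewrite integralZl// integral_mul_indic0 ?mule0//.
Qed.

(** Simple functions increase to [g]; since they stay below [K], [K * |N|] dominates the
    products. *)
Lemma integral_mul_ge0_bounded0 (g : U -> R) (K : R) : measurable_fun setT g ->
  (forall x, 0 <= g x <= K) -> (\int[mu]_w (N w * g (S w))%:E = 0)%E.
Proof.
move=> mg gK.
have mEg : measurable_fun setT (EFin \o g) by exact/measurable_EFinP.
have g0 x : setT x -> (0 <= (EFin \o g) x)%E by move=> _; rewrite lee_fin; case/andP: (gK x).
pose h := nnsfun_approx measurableT mEg.
have hcvg x : (fun n => h n x) @ \oo --> g x.
  by have /fine_cvgP[] := cvg_nnsfun_approx measurableT mEg g0 (x := x) Logic.I.
have hg n x : h n x <= g x.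
  rewrite -(cvg_lim _ (hcvg x))//; apply: nondecreasing_cvgn_le.
    by move=> p q pq; have /lefP := nd_nnsfun_approx measurableT mEg pq; exact.
  by apply/cvg_ex; exists (g x).
have [] := @dominated_convergence _ _ _ mu setT measurableT
   (fun n w => (N w * h n (S w))%:E) (fun w => (N w * g (S w))%:E)
   (fun w => K%:E * `|(N w)%:E|)%E.
- by move=> n; apply/measurable_EFinP/measurable_funM => //; apply: measurableT_comp.
- by apply/measurable_EFinP/measurable_funM => //; apply: measurableT_comp.
- apply: aeW => w _; apply: cvg_EFin; first exact: nearW.
  by apply: cvgM; [exact: cvg_cst|exact: hcvg].
- exact: integrableZl (integrable_abse iN).
- apply: aeW => w n _; rewrite /= normrM -EFinM lee_fin mulrC ler_wpM2r//.
  rewrite ger0_norm ?fun_ge0// (le_trans (hg _ _))//; by case/andP: (gK (S w)).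
move=> _ _; rewrite (_ : [sequence _]_n = cst 0%E); last first.
  by apply/funext => n /=; rewrite integral_mul_nnsfun0.
by move=> /cvg_lim <-//; rewrite lim_cst.
Qed.

(** Adding [K] makes [g] nonnegative, and the added constant contributes [K] times the integral of
    [N], which is 0. *)
Lemma integral_mul_bounded0 (g : U -> R) (K : R) : measurable_fun setT g ->
  (forall x, `|g x| <= K) -> (\int[mu]_w (N w * g (S w))%:E = 0)%E.
Proof.
move=> mg gK.
have mgK : measurable_fun setT (fun x => g x + K) by exact: measurable_funD.
have := @integral_mul_ge0_bounded0 (fun x => g x + K) (K + K) mgK.
have gKb x : 0 <= g x + K <= K + K.
  by have := gK x; rewrite ler_norml => /andP[? ?]; apply/andP; split; lra.
move=> /(_ gKb).
have i1 : mu.-integrable setT (fun w => (N w * g (S w))%:E).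
  by apply: integrable_mul_bounded => //; exact: measurableT_comp.
have i2 : mu.-integrable setT (fun w => ((N w) * K)%:E).
  by apply: (@integrable_mul_bounded (cst K) `|K|).
have N00 : (\int[mu]_w (N w * K)%:E = 0)%E.
  under eq_integral do rewrite EFinM.
  by rewrite integralZr//; have := N0 _ measurableT; rewrite preimage_setT => ->; rewrite mul0e.
under eq_integral do rewrite mulrDr EFinD.
by rewrite integralD// N00 adde0.
Qed.

End bounded_test_functions.

Lemma integral_eq_law d d' (T : measurableType d) (U : measurableType d') (R : realType)
  (mu : {measure set T -> \bar R}) (S S' : T -> U) (G : U -> R) :
  measurable_fun setT S -> measurable_fun setT S' -> measurable_fun setT G ->
  (forall B, measurable B -> mu (S @^-1` B) = mu (S' @^-1` B)) ->
  mu.-integrable setT (EFin \o (G \o S)) -> mu.-integrable setT (EFin \o (G \o S')) ->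
  (\int[mu]_w (G (S w))%:E = \int[mu]_w (G (S' w))%:E)%E.
Proof.
move=> mS mS' mG law iS iS'.
have mEG : measurable_fun setT (EFin \o G) by exact/measurable_EFinP.
have := integral_pushforward mS mEG (mu := mu) (D := setT).
rewrite preimage_setT => /(_ iS measurableT) /= <-.
have := integral_pushforward mS' mEG (mu := mu) (D := setT).
rewrite preimage_setT => /(_ iS' measurableT) /= <-.
by apply: eq_measure_integral => A mA _; exact: law.
Qed.

Section normal_integral.
Context {R : realType}.
Local Notation mu := (@lebesgue_measure R).
Variables (m s : R).

Let nu : probability _ R := normal_prob m s.

Let dens := Radon_Nikodym_SigmaFinite.f nu mu.

Let ae_dens : ae_eq mu setT dens (EFin \o normal_pdf m s).
Proof.
have dom := normal_prob_dominates m s : nu `<< mu.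
apply: integral_ae_eq => //.
- exact: Radon_Nikodym_SigmaFinite.f_integrable.
- apply/measurable_EFinP; exact: measurable_normal_pdf.
- move=> E _ mE; rewrite -Radon_Nikodym_SigmaFinite.f_integral//.
Qed.

(** Change of variables holds for the Radon-Nikodym derivative, which agrees almost everywhere with
    [normal_pdf] because both integrate to the same measure on every set. *)
Lemma ge0_integral_normal_prob (f : R -> \bar R) : (forall x, 0 <= f x)%E ->
  measurable_fun setT f ->
  (\int[normal_prob m s]_x f x = \int[mu]_x (f x * (normal_pdf m s x)%:E))%E.
Proof.
move=> f0 mf; have dom := normal_prob_dominates m s : nu `<< mu.
have := Radon_Nikodym_SigmaFinite.change_of_variables dom f0 measurableT mf.
move=> <-; apply: ae_eq_integral => //.
- apply: emeasurable_funM => //.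
  apply: (measurable_int mu); exact: Radon_Nikodym_SigmaFinite.f_integrable.
- apply: emeasurable_funM => //; apply/measurable_EFinP; exact: measurable_normal_pdf.
- by apply: ae_eqe_mul2l; exact: ae_dens.
Qed.

Lemma integral_normal_prob (f : R -> R) : measurable_fun setT f ->
  (\int[normal_prob m s]_x (f x)%:E = \int[mu]_x (f x * (normal_pdf m s x))%:E)%E.
Proof.
move=> mf; have mEf : measurable_fun setT (EFin \o f) by exact/measurable_EFinP.
rewrite integralE [RHS]integralE !ge0_integral_normal_prob//;
  [|exact: measurable_funeneg|exact: measurable_funepos].
congr (_ - _)%E; apply: eq_integral => x _.
- by rewrite !funeposE -EFin_max -EFinM maxr_pMl ?normal_pdf_ge0// mul0r EFin_max.
- by rewrite !funenegE -EFinN -EFin_max -EFinM maxr_pMl ?normal_pdf_ge0// mul0r mulNr EFin_max.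
Qed.

End normal_integral.

(** * Exchangeable pairs *)

Section alternating_step.
Context {R : realType}.
Variable k : R.

Let evens : set R := range (fun n : nat => k + n.*2%:R).
Let odds : set R := range (fun n : nat => k + n.*2.+1%:R).

(** On k + Z this is the solution of s(y) + s(y - 1) = 1_{y = k} that vanishes below k. As a
    difference of indicators of countable sets it is measurable on all of the reals. *)
Definition altstep (y : R) : R := \1_evens y - \1_odds y.

Lemma measurable_altstep : measurable_fun setT altstep.
Proof.
have m (f : nat -> R) : measurable (range f).
  apply: countable_measurable; first exact: measurable_set1.
  exact: card_image_le.
by apply: measurable_funB; apply: measurable_indic; exact: m.
Qed.

Lemma altstep_le1 y : `|altstep y| <= 1.
Proof.
by rewrite /altstep !indicE; do 2 case: (_ \in _);
  rewrite ?(subrr, subr0, sub0r, normrN, normr0, normr1).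
Qed.

(** Shifting by 1 exchanges the two sets, except that [evens] has the extra point k: the odd offsets
    start at k + 1. *)
Lemma altstepB1 y : altstep (y - 1) = (y == k)%:R - altstep y.
Proof.
have -> : altstep (y - 1) = \1_odds y - (\1_evens y - (y == k)%:R).
  have e1 : \1_evens (y - 1) = \1_odds y :> R.
    rewrite !indicE; congr (_ %:R); congr nat_of_bool; apply/idP/idP; rewrite !inE.
      move=> [n _ /= e]; exists n => //=; rewrite -natr1 addrA e; ring.
    move=> [n _ /= e]; exists n => //=; rewrite -e -natr1; ring.
  have e2 : \1_odds (y - 1) = \1_evens y - (y == k)%:R :> R.
    rewrite !indicE; have [->|yk] := eqVneq y k.
      rewrite [in RHS]mem_set; last by exists 0%N => //=; rewrite addr0.
      rewrite [in LHS]memNset ?subrr// => -[n _ /= e].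
      have : n.*2.+1%:R = -1 :> R by move: e => /(congr1 (fun z => z - k)); rewrite addrAC subrr add0r => ->; ring.
      by have := ler0n R n.*2.+1; lra.
    rewrite subr0; congr (_ %:R); congr nat_of_bool; apply/idP/idP; rewrite !inE.
      move=> [n _ /= e]; exists n.+1 => //=; rewrite doubleS -natr1 addrA e; ring.
    move=> [[|n] _ /= e]; first by move: e yk => <-; rewrite addr0 eqxx.
    by exists n => //=; rewrite -e doubleS -[n.*2.+2%:R]natr1; ring.
  by rewrite /altstep e1 e2.
by rewrite /altstep; ring.
Qed.

End alternating_step.

Lemma indic_set1 {R : realType} (a x : R) : (x == a)%:R = \1_[set a] x :> R.
Proof. by rewrite indicE; congr (_ %:R); congr nat_of_bool; apply/eqP/idP; rewrite inE. Qed.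

Lemma measurable_natr_eq {d} {T : measurableType d} {R : realType} (f : T -> R) (a : R) :
  measurable_fun setT f -> measurable_fun setT (fun w => (f w == a)%:R : R).
Proof.
move=> mf; under eq_fun do rewrite indic_set1.
by apply: measurableT_comp => //; exact: measurable_indic.
Qed.

(** Extends the defining identity of [condexp_WY] from events to bounded test functions of (W,
    Y). *)
Lemma condexp_WY_orth {d} {T : measurableType d} {R : realType} (P : probability T R)
    (W Y X M : T -> R) (g : R * R -> R) (K : R) :
  measurable_fun setT W -> measurable_fun setT Y ->
  condexp_WY P W Y X M -> measurable_fun setT g -> (forall x, `|g x| <= K) ->
  P.-integrable setT (fun w => ((X w - M w) * g (W w, Y w))%:E) /\
  (\int[P]_w ((X w - M w) * g (W w, Y w))%:E = 0)%E.
Proof.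
move=> mW mY [_ [iX [iM XM]]] mg gK.
have mWY : measurable_fun setT (fun w => (W w, Y w)) by exact: measurable_fun_pair.
have iN : P.-integrable setT (EFin \o (fun w => X w - M w)) by exact: integrableB_EFin.
split.
  apply: (@integrable_mul_bounded _ _ _ P _ iN (fun w => g (W w, Y w)) K) => //.
  exact: (measurableT_comp mg mWY).
apply: (@integral_mul_bounded0 _ _ _ _ _ P (fun w => (W w, Y w)) _ mWY iN _ _ K) => //.
move=> B mB; set D := _ @^-1` B.
have mD : measurable D by rewrite -[D]setTI; exact: mWY.
have iXD := integrableS measurableT mD (@subsetT _ _) iX.
have iMD := integrableS measurableT mD (@subsetT _ _) iM.
under eq_integral do rewrite EFinB.
by rewrite integralB_EFin// XM// subee// integrable_fin_num.
Qed.

(** With mean 0 the variance is the second moment, and |x| <= 1 + x^2. *)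
Lemma integrable_variance_fin {d} {T : measurableType d} {R : realType} (P : probability T R)
    (X : T -> R) : measurable_fun setT X -> ('E_P[X] = 0)%E -> ('V_P[X] = 1)%E ->
  P.-integrable setT (EFin \o X).
Proof.
move=> mX E0; rewrite /variance unlock E0 /= => V1.
have {}V1 : (\int[P]_w (X w ^+ 2)%:E = 1)%E.
  rewrite -V1 unlock; apply: eq_integral => w _.
  by rewrite /= /GRing.mul/= subr0 expr2.
have i2 : P.-integrable setT (EFin \o (fun w => X w ^+ 2)).
  apply/integrableP; split; first by apply/measurable_EFinP; exact: measurable_funX.
  under eq_integral do rewrite /= ger0_norm ?sqr_ge0//.
  by rewrite V1 ltry.
have i3 := integrableD_EFin _ _ _ P setT _ _ measurableT (finite_measure_integrable_cst P 1 measurableT) i2.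
apply: le_integrable i3 => //; first exact/measurable_EFinP.
move=> w _; rewrite /= lee_fin [leRHS]ger0_norm; last by rewrite addr_ge0 ?sqr_ge0.
have := sqr_ge0 (`|X w| - 1); rewrite -(real_normK (num_real (X w))).
have := normr_ge0 (X w); nra.
Qed.

Section exchangeable_pair.
Context {d : measure_display} {T : measurableType d} {R : realType}.
Variables (P : probability T R) (W Y W' Y' : T -> R) (k : R).
Hypotheses (mW : measurable_fun setT W) (mY : measurable_fun setT Y).
Hypotheses (mW' : measurable_fun setT W') (mY' : measurable_fun setT Y').
Hypothesis exch : forall B : set (((R * R) * R) * R), measurable B ->
  P ((fun w => (W w, Y w, W' w, Y' w)) @^-1` B) =
  P ((fun w => (W' w, Y' w, W w, Y w)) @^-1` B).

(** Exchangeability makes the integral equal to its own negative; it is finite by integrability,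
    hence 0. *)
Lemma integral_antisym0 (G : ((R * R) * R) * R -> R) : measurable_fun setT G ->
  (forall w y w' y', G (w', y', w, y) = - G (w, y, w', y')) ->
  P.-integrable setT (fun w => (G (W w, Y w, W' w, Y' w))%:E) ->
  (\int[P]_w (G (W w, Y w, W' w, Y' w))%:E = 0)%E.
Proof.
move=> mG asym iG.
have mV : measurable_fun setT (fun w => (W w, Y w, W' w, Y' w)).
  by do 3 (apply: measurable_fun_pair => //).
have mV' : measurable_fun setT (fun w => (W' w, Y' w, W w, Y w)).
  by do 3 (apply: measurable_fun_pair => //).
have iG' : P.-integrable setT (fun w => (G (W' w, Y' w, W w, Y w))%:E).
  have := integrableN iG; apply: eq_integrable => // w _.
  by rewrite /= [in RHS]asym EFinN.
have := integral_eq_law _ _ _ _ _ P _ _ G mV mV' mG exch iG iG'.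
under [X in _ = X -> _]eq_integral do rewrite asym EFinN.
rewrite integralN; last exact: (integrable_add_def measurableT iG).
have := integrable_fin_num measurableT iG.
case: (\int[P]_w _)%E => // r _ [] rr; congr (_%:E); lra.
Qed.

Local Notation s := (altstep k).
Local Notation D w := (W' w - W w).
Local Notation Ip w := ((Y' w - Y w == 1)%:R).
Local Notation Im w := ((Y' w - Y w == -1)%:R).
Local Notation s' y := ((y == k)%:R - s y).

(** Swapping the pair flips [D], fixes the midpoint and exchanges up-steps with down-steps. [G]
    writes the weight [s' (Y w)] in terms of [Y] alone, as conditioning on (W, Y) requires. *)
Lemma stein_flux0 (f : R -> R) : measurable_fun setT f -> (forall x, `|f x| <= 1) ->
  P.-integrable setT (EFin \o (fun w => D w * Ip w)) ->
  P.-integrable setT (EFin \o (fun w => D w * Im w)) ->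
  let G w := D w * f ((W w + W' w) / 2) * (Ip w * s (Y w) + Im w * s' (Y w)) in
  P.-integrable setT (EFin \o G) /\ (\int[P]_w (G w)%:E = 0)%E.
Proof.
move=> mf f1 iDp iDm G.
(* In [H] both kinds of step carry [s] at the lower of the two values of Y, which makes the
   antisymmetry visible. *)
pose H (z : ((R * R) * R) * R) := (z.1.2 - z.1.1.1) * f ((z.1.1.1 + z.1.2) / 2) *
  ((z.2 - z.1.1.2 == 1)%:R * s z.1.1.2 + (z.2 - z.1.1.2 == -1)%:R * s z.2).
have m1 : measurable_fun setT (fun z : ((R * R) * R) * R => z.1.1.1).
  by apply: measurableT_comp => //; apply: measurableT_comp.
have m2 : measurable_fun setT (fun z : ((R * R) * R) * R => z.1.1.2).
  by apply: measurableT_comp => //; apply: measurableT_comp.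
have m3 : measurable_fun setT (fun z : ((R * R) * R) * R => z.1.2).
  by apply: measurableT_comp.
have m4 : measurable_fun setT (fun z : ((R * R) * R) * R => z.2) by exact: measurable_snd.
have ms := measurable_altstep k.
have mH : measurable_fun setT H.
  apply: measurable_funM.
    apply: measurable_funM; first exact: measurable_funB.
    apply: measurableT_comp => //; apply: measurable_funM => //.
    exact: measurable_funD.
  have m24 := measurable_funB m4 m2.
  apply: measurable_funD; apply: measurable_funM.
  - exact: measurable_natr_eq m24.
  - exact: (measurableT_comp ms m2).
  - exact: measurable_natr_eq m24.
  - exact: (measurableT_comp ms m4).
have HE w : H (W w, Y w, W' w, Y' w) = G w.
  rewrite /H /G /=; have [e|_] := eqVneq (Y' w - Y w) (-1); last by rewrite !mul0r.
  have -> : Y' w = Y w - 1 by move/eqP: e; rewrite subr_eq => /eqP ->; ring.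
  by rewrite altstepB1.
have iG : P.-integrable setT (EFin \o G).
  have mm : measurable_fun setT (fun w => f ((W w + W' w) / 2)).
    by apply: measurableT_comp => //; apply: measurable_funM => //; exact: measurable_funD.
  have i1 := integrable_mul_bounded _ _ _ _ _ iDp (fun w => f ((W w + W' w) / 2) * s (Y w)) 1.
  have i2 := integrable_mul_bounded _ _ _ _ _ iDm (fun w => f ((W w + W' w) / 2) * s (Y w - 1)) 1.
  apply: eq_integrable (integrableD_EFin _ _ _ _ _ _ _ measurableT (i1 _ _) (i2 _ _)) => //.
  - by move=> w _; rewrite /= altstepB1 /G; congr EFin; ring.
  - by apply: measurable_funM => //; exact: measurableT_comp.
  - by move=> w; rewrite normrM mulr_ile1// altstep_le1.
  - by apply: measurable_funM => //; apply: measurableT_comp => //; exact: measurable_funB.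
  - by move=> w; rewrite normrM mulr_ile1// altstep_le1.
split=> //.
under eq_integral do rewrite -HE.
apply: integral_antisym0 => //.
- move=> w y w' y'; rewrite /H /=.
  have -> : (y - y' == 1) = (y' - y == -1) by rewrite -eqr_opp opprB.
  have -> : (y - y' == -1) = (y' - y == 1) by rewrite -eqr_opp opprB opprK.
  by rewrite [w' + w]addrC; ring.
- by apply: eq_integrable iG => // w _; rewrite /= HE.
Qed.

Variables (lambda psi : R) (R1p R1m R2p R2m : T -> R).
Hypotheses (mR1p : measurable_fun setT R1p) (mR1m : measurable_fun setT R1m).
Hypotheses (mR2p : measurable_fun setT R2p) (mR2m : measurable_fun setT R2m).
Hypothesis lambda0 : 0 < lambda.
Hypothesis iW : P.-integrable setT (EFin \o W).
Hypothesis c1p : condexp_WY P W Y (fun w => D w * Ip w)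
  (fun w => - lambda * (2^-1 * psi * W w + R1p w)).
Hypothesis c1m : condexp_WY P W Y (fun w => D w * Im w)
  (fun w => - lambda * (2^-1 * psi * W w + R1m w)).
Hypothesis c2p : condexp_WY P W Y (fun w => D w ^+ 2 * Ip w)
  (fun w => lambda * (psi + R2p w)).
Hypothesis c2m : condexp_WY P W Y (fun w => D w ^+ 2 * Im w)
  (fun w => lambda * (psi + R2m w)).

Local Notation c := (2 * normal_pdf 0 1 0 : R).
(** Collects the Taylor error, the remainders on Y = k, and the differences of remainders carried by
    [s]; here [2] and [c] come from the bounds on 2 f and f'. *)
Let bnd w := 2^-1 * `|D w| ^+ 3 +
  lambda * ((Y w == k)%:R * (2 * `|R1m w| + c * `|R2m w|) +
            (2 * `|R1p w - R1m w| + c * `|R2p w - R2m w|)).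

(** A variable [U] of mean 0 differs pointwise by at most [bnd] from the Stein expression on Y = k,
    scaled by [lambda * psi]. *)
Lemma stein_bound (h : R -> R) (N : R) : one_lipschitz h ->
  N = \int[lebesgue_measure]_t (h t * normal_pdf 0 1 t) ->
  P.-integrable setT (EFin \o (fun w => (Y w == k)%:R * (h (W w) - N))) /\
  (`|\int[P]_w (lambda * psi * ((Y w == k)%:R * (h (W w) - N)))%:E| <=
   \int[P]_w (bnd w)%:E)%E.
Proof.
move=> lh NE.
have [f [f' [df fE f1 f'c f'lip]]] := stein_solution h lh.
rewrite -NE in fE.
have cf : continuous f.
  by move=> x; apply: differentiable_continuous; apply/derivable1_diffP; have dx := df x; exact: ex_derive.
have mf : measurable_fun setT f by exact: continuous_measurable_fun.
have mh : measurable_fun setT h.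
  by apply: continuous_measurable_fun; exact: one_lipschitz_continuous.
have mf' : measurable_fun setT f'.
  have -> : f' = (fun x => x * f x + (h x - N)) by apply/funext => x; rewrite -fE; ring.
  by apply: measurable_funD; [exact: measurable_funM|exact: measurable_funB].
have ms := measurable_altstep k.
have ms' : measurable_fun setT (fun y => s' y).
  by apply: measurable_funB => //; apply: (measurable_natr_eq id k); exact: measurable_id.
have s'1 y : `|s' y| <= 1 by rewrite -altstepB1 altstep_le1.
have s1 := altstep_le1 k.
have mfst : measurable_fun setT (fun z : R * R => z.1) by exact: measurable_fst.
have msnd : measurable_fun setT (fun z : R * R => z.2) by exact: measurable_snd.
have bf1 (g : R -> R) (x y : R) : `|g y| <= 1 -> `|2 * f x * g y| <= 2.
  move=> g1; rewrite !normrM (ger0_norm (ler0n _ 2)).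
  by rewrite -[leRHS]mulr1 -mulrA ler_wpM2l// mulr_ile1.
have bf' (g : R -> R) (x y : R) : `|g y| <= 1 -> `|f' x * g y| <= c.
  by move=> g1; rewrite normrM -[leRHS]mulr1 ler_pM.
have mg1 (g : R -> R) : measurable_fun setT g -> measurable_fun setT (fun z : R * R => 2 * f z.1 * g z.2).
  move=> mg; apply: measurable_funM; last exact: (measurableT_comp mg).
  by apply: measurable_funM => //; exact: (measurableT_comp mf).
have mg2 (g : R -> R) : measurable_fun setT g -> measurable_fun setT (fun z : R * R => f' z.1 * g z.2).
  move=> mg; apply: measurable_funM; last exact: (measurableT_comp mg).
  exact: (measurableT_comp mf').
have Z1 := condexp_WY_orth P _ _ _ _ _ 2 mW mY c1p (mg1 _ ms) (fun z => bf1 (altstep k) z.1 z.2 (s1 z.2)).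
have Z2 := condexp_WY_orth P _ _ _ _ _ c mW mY c2p (mg2 _ ms) (fun z => bf' (altstep k) z.1 z.2 (s1 z.2)).
have Z3 := condexp_WY_orth P _ _ _ _ _ 2 mW mY c1m (mg1 _ ms') (fun z => bf1 (fun y => s' y) z.1 z.2 (s'1 z.2)).
have Z4 := condexp_WY_orth P _ _ _ _ _ c mW mY c2m (mg2 _ ms') (fun z => bf' (fun y => s' y) z.1 z.2 (s'1 z.2)).
have ZD (a b : T -> R) : P.-integrable setT (EFin \o a) /\ (\int[P]_w (a w)%:E = 0)%E ->
    P.-integrable setT (EFin \o b) /\ (\int[P]_w (b w)%:E = 0)%E ->
    P.-integrable setT (EFin \o (fun w => a w - b w)) /\ (\int[P]_w (a w - b w)%:E = 0)%E.
  move=> [ia a0] [ib b0]; split; first exact: integrableB_EFin.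
  by under eq_integral do rewrite EFinB; rewrite integralB_EFin// a0 b0 sube0.
have [iG G0] := stein_flux0 f mf f1 (proj1 (proj2 c1p)) (proj1 (proj2 c1m)).
(* To first order 2 G is (2 D f(W) + D^2 f'(W)) times the step weight, since the midpoint lies at
   distance D / 2 from W. Subtracting [Z1] to [Z4] replaces these increments by their conditional
   moments. *)
have iGG := ZD _ _ (ZD _ _ (ZD _ _ (ZD _ _ (conj (integrableZr_EFin _ _ _ _ _ _ 2 measurableT iG) _) Z1) Z2) Z3) Z4.
set U := (X in P.-integrable setT (EFin \o X)) in iGG.
have {iGG}[|iU U0] := iGG.
  by under eq_integral do rewrite EFinM; rewrite integralZl// G0 mule0.
have iQ0 : P.-integrable setT (EFin \o (fun w => (Y w == k)%:R * (h (W w) - N))).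
  have iN : P.-integrable setT (EFin \o (fun w => h (W w) - N)).
    apply: le_integrable (integrableD_EFin _ _ _ P setT (cst `|h 0 - N|) (fun w => `|W w|)
       measurableT (finite_measure_integrable_cst P _ measurableT) (integrable_norm iW)) => //.
      by apply/measurable_EFinP/measurable_funB => //; exact: measurableT_comp.
    move=> w _; rewrite /= lee_fin [leRHS]ger0_norm ?addr_ge0//.
    have -> : h (W w) - N = (h 0 - N) + (h (W w) - h 0) by ring.
    by rewrite (le_trans (ler_normD _ _))// lerD2l (le_trans (lh _ _))// subr0.
  have := integrable_mul_bounded _ _ _ _ _ iN (fun w => (Y w == k)%:R) 1 (measurable_natr_eq _ _ mY).
  have b1 w : `|(Y w == k)%:R| <= 1 :> R by case: (_ == _); rewrite ?normr1 ?normr0.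
  by move=> /(_ b1); apply: eq_integrable => // w _; rewrite /= mulrC.
split=> //.
have iQ : P.-integrable setT (EFin \o (fun w => lambda * psi * ((Y w == k)%:R * (h (W w) - N)))).
  exact: integrableZr_EFin.
have UE w : `|U w - lambda * psi * ((Y w == k)%:R * (h (W w) - N))| <= bnd w.
  rewrite -fE /U /bnd.
  have -> : (W w + W' w) / 2 = W w + D w / 2 by field.
  have := taylor1_lip f f' 1 (W w) (D w / 2) df f'lip; rewrite mul1r.
  set e := f _ - _ - _ => te.
  have fmid : f (W w + D w / 2) = e + f (W w) + D w / 2 * f' (W w) by rewrite /e; ring.
  rewrite fmid.
  (* At most one of the two step indicators is nonzero. *)
  have theta1 : `|Ip w * s (Y w) + Im w * s' (Y w)| <= 1.
    have [->|_] := eqVneq (Y' w - Y w) 1.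
      have /negbTE -> : 1 != -1 :> R by rewrite gt_eqF//; lra.
      by rewrite mul1r mul0r addr0.
    rewrite mul0r add0r; case: (_ == -1); first by rewrite mul1r.
    by rewrite mul0r normr0.
  have k01 : 0 <= (Y w == k)%:R :> R by rewrite ler0n.
  move: (f1 (W w)) (f'c (W w)) (s1 (Y w)) theta1 k01 te.
  move: ((Y w == k)%:R : R) (Ip w : R) (Im w : R) (s (Y w)) => K ip im sy.
  rewrite /=; clear fmid; clearbody e.
  move: e (f (W w)) (f' (W w)) => e F F' F1 F'c sy1 theta1 K0 te.
  have lin r1 r2 : `|- (2 * F * r1) + F' * r2| <= 2 * `|r1| + c * `|r2|.
    rewrite (le_trans (ler_normD _ _))// normrN !normrM (ger0_norm (ler0n _ 2)).
    apply: lerD; last by rewrite ler_wpM2r.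
    by rewrite ler_wpM2r// ler_piMr.
  (* The weights [sy] and [K - sy] add up to [K], so the main parts of the moments sum to
     [lambda * psi * K * (F' - W F)], which is exactly the term subtracted. *)
  rewrite [X in `|X|](_ : _ = 2 * (D w * e) * (ip * sy + im * (K - sy)) +
     lambda * (K * (- (2 * F * R1m w) + F' * R2m w) +
        sy * (- (2 * F * (R1p w - R1m w)) + F' * (R2p w - R2m w)))); last by field.
  apply: le_trans (ler_normD _ _) _; apply: lerD.
    rewrite normrM -[leRHS]mulr1; apply: ler_pM => //.
    rewrite !normrM (ger0_norm (ler0n _ 2)).
    (* The displacement is D / 2, so the Taylor error is at most (D / 2)^2; this is where the
       constant 1/2 arises. *)
    have -> : 2^-1 * `|D w| ^+ 3 = 2 * (`|D w| * (`|D w| / 2) ^+ 2) by field.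
    rewrite ler_wpM2l// ler_wpM2l// (le_trans te)// !exprMn.
    by rewrite real_normK ?num_real.
  rewrite normrM (gtr0_norm lambda0) ler_wpM2l ?(ltW lambda0)//.
  apply: le_trans (ler_normD _ _) _; rewrite !(normrM K) !(normrM sy) (ger0_norm K0).
  apply: lerD; first by rewrite ler_wpM2l.
  apply: le_trans (lin _ _); rewrite -[leRHS]mul1r; exact: ler_wpM2r.
(* As [U] has integral 0, only the pointwise difference remains to be integrated. *)
have -> : (\int[P]_w (lambda * psi * ((Y w == k)%:R * (h (W w) - N)))%:E =
   - \int[P]_w (U w - lambda * psi * ((Y w == k)%:R * (h (W w) - N)))%:E)%E.
  under [in RHS]eq_integral do rewrite EFinB.
  by rewrite [in RHS]integralB_EFin// U0 sub0e oppeK.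
rewrite abseN; apply: le_trans (le_abse_integral _ _ _) _ => //.
  by apply: measurable_int; exact: integrableB_EFin iU iQ.
apply: ge0_le_integral => //.
- apply/measurable_EFinP; apply: measurableT_comp => //.
  by apply/measurable_EFinP; apply: measurable_int; exact: integrableB_EFin iU iQ.
- apply/measurable_EFinP; apply: measurable_funD.
    apply: measurable_funM => //; apply: measurable_funX; apply: measurableT_comp => //.
    exact: measurable_funB.
  apply: measurable_funM => //; apply: measurable_funD.
    apply: measurable_funM; first exact: measurable_natr_eq.
    by apply: measurable_funD; apply: measurable_funM => //; exact: measurableT_comp.
  by apply: measurable_funD; apply: measurable_funM => //; apply: measurableT_comp => //;
    exact: measurable_funB.
- by move=> w _; rewrite /= lee_fin UE.
Qed.
End exchangeable_pair.

(** * From the moment bound to conditional expectations and constants *)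

Lemma ge0_integral_lincomb {d} {T : measurableType d} {R : realType}
    (mu : {measure set T -> \bar R}) (x y : R) (f g : T -> R) :
  0 <= x -> 0 <= y -> measurable_fun setT f -> measurable_fun setT g ->
  (forall w, 0 <= f w) -> (forall w, 0 <= g w) ->
  (\int[mu]_w (x * f w + y * g w)%:E =
   x%:E * \int[mu]_w (f w)%:E + y%:E * \int[mu]_w (g w)%:E)%E.
Proof.
move=> x0 y0 mf mg f0 g0.
under eq_integral do rewrite EFinD.
rewrite ge0_integralD//; first 1 last.
- by move=> w _; rewrite lee_fin mulr_ge0.
- by apply/measurable_EFinP; exact: measurable_funM.
- by move=> w _; rewrite lee_fin mulr_ge0.
- by apply/measurable_EFinP; exact: measurable_funM.
under eq_integral do rewrite EFinM.
under [X in (_ + X)%E]eq_integral do rewrite EFinM.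
rewrite !ge0_integralZl_EFin//; try exact/measurable_EFinP; by move=> w _; rewrite lee_fin.
Qed.

Lemma integral_event_natr {d} {T : measurableType d} {R : realType}
    (mu : {measure set T -> \bar R}) (Y : T -> R) (k : R) (f : T -> R) :
  (\int[mu]_(w in [set w | Y w = k]) (f w)%:E = \int[mu]_w ((Y w == k)%:R * f w)%:E)%E.
Proof.
rewrite integral_mkcond epatch_indic; apply: eq_integral => w _.
rewrite /= indicE -EFinM mulrC; congr (_ %:R * _)%:E; congr nat_of_bool.
by apply/idP/eqP; rewrite inE.
Qed.

(** Both sides are nonnegative with equal squares, as 4 phi(0)^2 = 2 / pi. *)
Lemma sqrt_two_div_pi_sqr {R : realType} (psi : R) : 0 < psi ->
  Num.sqrt (2 / (pi * psi ^+ 2)) = 2 * normal_pdf 0 1 0 / psi.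
Proof.
move=> psi0; have p0 : 0 <= 2 * normal_pdf 0 1 0 / psi.
  by rewrite divr_ge0 ?mulr_ge0 ?normal_pdf_ge0// ltW.
rewrite -[RHS](ger0_norm p0) -sqrtr_sqr; congr Num.sqrt.
rewrite !exprMn phi0_sqr exprVn; have := pi_gt0 R; move: pi => q q0; field.
by rewrite !gt_eqF.
Qed.

(** Arithmetic in the extended reals, where nonnegativity allows distributing over possibly infinite
    terms. All coefficients agree except that of the third moment. The factors [1%:E] match the
    output of [ge0_integral_lincomb]. *)
Lemma stein_bound_combine {R : realType} (lambda psi p c : R) (a b C D T : \bar R) :
  0 < lambda -> 0 < psi -> 0 < p -> 0 <= c ->
  (0 <= a -> 0 <= b -> 0 <= C -> 0 <= D -> 0 <= T ->
  ((lambda * psi * p)^-1)%:E * ((2^-1)%:E * T +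
     lambda%:E * (1%:E * (2%:E * a + c%:E * b) + 1%:E * (2%:E * C + c%:E * D))) <=
  (2 / psi)%:E * (a * (p^-1)%:E + (p^-1)%:E * C) +
  (c / psi)%:E * (b * (p^-1)%:E + (p^-1)%:E * D) +
  (2 / (3 * lambda * psi * p))%:E * T)%E.
Proof.
move=> l0 ps0 p0 c0 a0 b0 C0 D0 T0.
have ip0 : 0 <= p^-1 by rewrite invr_ge0 ltW.
have il0 : 0 <= lambda by rewrite ltW.
have H (x : R) (y : \bar R) : 0 <= x -> (0 <= y -> 0 <= x%:E * y)%E.
  by move=> x0 y0; rewrite mule_ge0// lee_fin.
rewrite (muleC a) (muleC b) !mul1e.
have h1 := H _ _ (ler0n R 2) a0; have h2 := H _ _ c0 b0.
have h3 := H _ _ (ler0n R 2) C0; have h4 := H _ _ c0 D0.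
have h5 : 0 <= 2^-1 :> R by rewrite invr_ge0.
rewrite ge0_muleDr; [|exact: H|apply: H => //; by rewrite !adde_ge0].
rewrite (@ge0_muleDr _ lambda%:E); [|by rewrite adde_ge0|by rewrite adde_ge0].
rewrite !(@ge0_muleDr _ lambda%:E)//.
rewrite (@ge0_muleDr _ (lambda * psi * p)^-1%:E); [|by rewrite adde_ge0 ?H|by rewrite adde_ge0 ?H].
rewrite !(@ge0_muleDr _ (lambda * psi * p)^-1%:E)//; try exact: H.
rewrite (@ge0_muleDr _ (2 / psi)%:E); [|exact: H|exact: H].
rewrite (@ge0_muleDr _ (c / psi)%:E); [|exact: H|exact: H].
rewrite !muleA -!EFinM [leLHS]addeC addeACA.
have n1 : lambda != 0 by rewrite gt_eqF.
have n2 : psi != 0 by rewrite gt_eqF.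
have n3 : p != 0 by rewrite gt_eqF.
apply: leeD.
  rewrite le_eqVlt; apply/orP; left; apply/eqP.
  by congr ((_%:E * _ + _%:E * _) + (_%:E * _ + _%:E * _))%E; field; rewrite ?n1 ?n2 ?n3.
apply: lee_wpmul2r => //; rewrite lee_fin -subr_ge0.
(* The proof yields 1/2 where 2/3 is claimed; the slack is 1/6. *)
have -> : 2 / (3 * lambda * psi * p) - (lambda * psi * p)^-1 / 2 =
   6^-1 * (lambda^-1 * psi^-1 * p^-1) by field; rewrite ?n1 ?n2 ?n3.
by rewrite !mulr_ge0// invr_ge0// ltW.
Qed.

Theorem theorem2p1 (d : measure_display) (T : measurableType d) (R : realType)
  (P : probability T R) (W Y W' Y' : T -> R)
  (sigmaY zeta lambda psi : R)
  (R0p R0m R1p R1m R2p R2m : T -> R) (k : R) :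
  (* random variables *)
  measurable_fun setT W -> measurable_fun setT Y ->
  measurable_fun setT W' -> measurable_fun setT Y' ->
  measurable_fun setT R0p -> measurable_fun setT R0m ->
  measurable_fun setT R1p -> measurable_fun setT R1m ->
  measurable_fun setT R2p -> measurable_fun setT R2m ->
  (* (I) *)
  ('E_P[W] = 0)%E -> ('V_P[W] = 1)%E ->
  ('E_P[Y] = 0)%E -> ('V_P[Y] = (sigmaY ^+ 2)%:E)%E ->
  covariance P W Y = 0%E ->
  (forall B : set (((R * R) * R) * R), measurable B ->
     P ((fun w => (W w, Y w, W' w, Y' w)) @^-1` B) =
     P ((fun w => (W' w, Y' w, W w, Y w)) @^-1` B)) ->
  (* (II) *)
  0 <= zeta < 1 ->
  {ae P, forall w, exists z : int, Y w = zeta + z%:~R} ->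
  {ae P, forall w, Y' w - Y w \in [:: -1; 0; 1]} ->
  0 < lambda < 1 ->
  condexp_WY P W Y (fun w => (Y' w - Y w == 1)%:R)
    (fun w => lambda * sigmaY ^+ 2 + R0p w) ->
  condexp_WY P W Y (fun w => (Y' w - Y w == -1)%:R)
    (fun w => lambda * sigmaY ^+ 2 + R0m w) ->
  (* (III) *)
  0 < psi ->
  condexp_WY P W Y (fun w => (W' w - W w) * (Y' w - Y w == 1)%:R)
    (fun w => - lambda * (2^-1 * psi * W w + R1p w)) ->
  condexp_WY P W Y (fun w => (W' w - W w) * (Y' w - Y w == -1)%:R)
    (fun w => - lambda * (2^-1 * psi * W w + R1m w)) ->
  (* (IV) *)
  condexp_WY P W Y (fun w => (W' w - W w) ^+ 2 * (Y' w - Y w == 1)%:R)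
    (fun w => lambda * (psi + R2p w)) ->
  condexp_WY P W Y (fun w => (W' w - W w) ^+ 2 * (Y' w - Y w == -1)%:R)
    (fun w => lambda * (psi + R2m w)) ->
  (* p_k > 0 *)
  (0 < P [set w | Y w = k])%E ->
  let pk := fine (P [set w | Y w = k]) in
  let Yk := [set w | Y w = k] in
  let Ak := condE_event P Yk (fun w => `|R1m w|%:E) in
  let Bk := condE_event P Yk (fun w => `|R2m w|%:E) in
  let C := ('E_P[fun w => `|R1p w - R1m w|%R])%E in
  let D := ('E_P[fun w => `|R2p w - R2m w|%R])%E in
  (dW_cond_normal P W Yk <=
     (2 / psi)%:E * (Ak + (pk^-1)%:E * C)
   + (Num.sqrt (2 / (pi * psi ^+ 2)))%:E * (Bk + (pk^-1)%:E * D)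
   + (2 / (3 * lambda * psi * pk))%:E * 'E_P[fun w => (`|W' w - W w| ^+ 3)%R])%E.
Proof.
move=> mW mY mW' mY' _ _ mR1p mR1m mR2p mR2m EW VW _ _ _ exch _ _ _ /andP[lambda0 _] _ _.
move=> psi0 c1p c1m c2p c2m pY; lazy zeta.
set Yk := [set w | Y w = k]; set pk := fine (P Yk).
have iW := integrable_variance_fin P W mW EW VW.
have mYk : measurable Yk.
  by have := mY measurableT _ (measurable_set1 k); rewrite setTI.
have pk_fin : P Yk = pk%:E by rewrite /pk fineK// fin_num_measure.
have pk0 : 0 < pk by rewrite -lte_fin -pk_fin.
apply: ge_ereal_sup => _ [h lh <-].
have mh : measurable_fun setT h.
  by apply: continuous_measurable_fun; exact: one_lipschitz_continuous.
set N := \int[lebesgue_measure]_t (h t * normal_pdf 0 1 t).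
have -> : (\int[normal_prob 0 1]_x (h x)%:E = N%:E)%E.
  rewrite integral_normal_prob// /N /Rintegral fineK//.
  exact: (integrable_fin_num measurableT (integrable_lip_phi h lh)).
have [iQ bQ] := stein_bound P W Y W' Y' k mW mY mW' mY' exch lambda psi R1p R1m R2p R2m
  mR1p mR1m mR2p mR2m lambda0 iW c1p c1m c2p c2m h N lh erefl.
have := integrable_fin_num measurableT iQ.
case Er : (\int[P]_w _)%E => [r| |]// _.
(* As [r] is the integral of 1_{Y = k} (h(W) - N), the quantity to bound becomes |r / pk|. *)
have -> : condE_event P Yk (fun w => (h (W w))%:E) = (r / pk + N)%:E.
  rewrite /condE_event -/pk integral_event_natr.
  have -> : (\int[P]_w ((Y w == k)%:R * h (W w))%:E = (r + N * pk)%:E)%E.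
    rewrite (EFinD r) -Er EFinM -pk_fin.
    have iK : P.-integrable setT (EFin \o (fun w => (Y w == k)%:R * N)).
      have := integrable_mul_bounded _ _ _ P (cst N) (finite_measure_integrable_cst P N measurableT)
        (fun w => (Y w == k)%:R) 1 (measurable_natr_eq _ _ mY).
      have b1 w : `|(Y w == k)%:R| <= 1 :> R by case: (_ == _); rewrite ?normr1 ?normr0.
      by move=> /(_ b1); apply: eq_integrable => // w _; rewrite /= mulrC.
    rewrite -integral_cst// [X in (_ + X)%E]integral_event_natr -integralD//.
    by apply: eq_integral => w _; rewrite /= -EFinD -mulrDr subrK.
  by rewrite -EFinM; congr EFin; field; rewrite gt_eqF.
rewrite -EFinB addrK abse_EFin.
(* The integrand is regrouped into nested two-term combinations, one application of
   [ge0_integral_lincomb] each. *)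
have {}bQ : ((lambda * psi * `|r|)%:E <= \int[P]_w (2^-1 * `|W' w - W w| ^+ 3 + lambda *
    (1 * (2 * ((Y w == k)%:R * `|R1m w|) + 2 * normal_pdf 0 1 0 * ((Y w == k)%:R * `|R2m w|)) +
     1 * (2 * `|R1p w - R1m w| + 2 * normal_pdf 0 1 0 * `|R2p w - R2m w|)))%:E)%E.
  move: bQ; under eq_integral do rewrite EFinM.
  rewrite integralZl// Er -EFinM /= normrM gtr0_norm ?mulr_gt0// => /le_trans; apply.
  by rewrite le_eqVlt; apply/orP; left; apply/eqP; apply: eq_integral => w _; congr EFin; ring.
have c0 : 0 <= 2 * normal_pdf 0 1 0 :> R by rewrite mulr_ge0// normal_pdf_ge0.
have mK := measurable_natr_eq Y k mY.
have mn (f : T -> R) : measurable_fun setT f -> measurable_fun setT (fun w => `|f w|).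
  by move=> mf; exact: measurableT_comp.
have m1 := measurable_funM mK (mn _ mR1m).
have m2 := measurable_funM mK (mn _ mR2m).
have m3 := mn _ (measurable_funB mR1p mR1m).
have m4 := mn _ (measurable_funB mR2p mR2m).
have m5 : measurable_fun setT (fun w => `|W' w - W w| ^+ 3).
  by apply: measurable_funX; apply: mn; exact: measurable_funB.
have m12 : measurable_fun setT (fun w => 2 * ((Y w == k)%:R * `|R1m w|) +
    2 * normal_pdf 0 1 0 * ((Y w == k)%:R * `|R2m w|)).
  by apply: measurable_funD; apply: measurable_funM.
have m34 : measurable_fun setT (fun w => 2 * `|R1p w - R1m w| + 2 * normal_pdf 0 1 0 * `|R2p w - R2m w|).
  by apply: measurable_funD; apply: measurable_funM.
have m1234 : measurable_fun setT (fun w =>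
    1 * (2 * ((Y w == k)%:R * `|R1m w|) + 2 * normal_pdf 0 1 0 * ((Y w == k)%:R * `|R2m w|)) +
    1 * (2 * `|R1p w - R1m w| + 2 * normal_pdf 0 1 0 * `|R2p w - R2m w|)).
  by apply: measurable_funD; apply: measurable_funM.
have p1 w : 0 <= (Y w == k)%:R * `|R1m w| by rewrite mulr_ge0.
have p2 w : 0 <= (Y w == k)%:R * `|R2m w| by rewrite mulr_ge0.
have p12 w : 0 <= 2 * ((Y w == k)%:R * `|R1m w|) + 2 * normal_pdf 0 1 0 * ((Y w == k)%:R * `|R2m w|).
  by rewrite addr_ge0 ?mulr_ge0// normal_pdf_ge0.
have p34 w : 0 <= 2 * `|R1p w - R1m w| + 2 * normal_pdf 0 1 0 * `|R2p w - R2m w|.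
  by rewrite addr_ge0 ?mulr_ge0// normal_pdf_ge0.
move: bQ; rewrite ge0_integral_lincomb ?(ltW lambda0) ?invr_ge0//; last first.
  by move=> w; rewrite !mul1r addr_ge0.
rewrite !ge0_integral_lincomb// => bQ.
rewrite sqrt_two_div_pi_sqr// /condE_event -/pk !integral_event_natr !unlock.
apply: le_trans (stein_bound_combine _ _ _ _ _ _ _ _ _ lambda0 psi0 pk0 c0 _ _ _ _ _);
  [|by apply: integral_ge0 => w _; rewrite lee_fin..].
have -> : `|r / pk|%:E = ((lambda * psi * pk)^-1%:E * (lambda * psi * `|r|)%:E)%E.
  rewrite -EFinM normrM normfV (gtr0_norm pk0); congr EFin; field.
  by rewrite !gt_eqF.
by apply: lee_wpmul2l => //; rewrite lee_fin invr_ge0 !mulr_ge0 ?ltW.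
Qed.
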